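(* Let $X, Y, E$ be sets, let $f\colon X \to X$, $g\colon E\times Y \to Y$ and $p\colon X \to E$ be functions, and let $(X\times Y, f\rtimes_p g)$ be the resulting semi-direct product. Let $n \geq 1$. For each orbit $\omega$ of the $\mathbb{Z}/n$-set $AS(X,f)_n$, let $k_\omega := |\omega|$, and choose $c_\omega \in AS(X,f)_{k_\omega}$ to be a non-degenerate $k_\omega$-cycle such that $c_\omega \mu_{n,k_\omega} \in \omega$. Then there is an isomorphism of $(\mathbb{Z}/n)$-sets $$AS(X\times Y, f\rtimes_p g)_n \;\cong\; \coprod_{\omega \in \mathrm{Orb}(AS(X,f)_n)} AS\big(\mathbb{Z}/k_\omega \times Y,\ \mathrm{succ} \rtimes_{p\, c_\omega} g\big)_n .$$ Moreover, up to isomorphism, the dynamical system $(\mathbb{Z}/k_\omega\times Y, \mathrm{succ}\rtimes_{p\,c_\omega} g)$ does not depend on the choice of $c_\omega$ within its orbit.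
   Context: A discrete dynamical system is a pair $(X,f)$ with $X$ a set and $f\colon X\to X$; a morphism $(X,f)\to(Y,g)$ is a function $\alpha\colon X \to Y$ with $\alpha f = g\alpha$. $(\mathbb{Z}/n,\mathrm{succ})$ is the system $i\mapsto i+1 \bmod n$. Semi-direct product: given functions $f\colon X\to X$, $g\colon E\times Y\to Y$, $p\colon X\to E$, $f\rtimes_p g\colon X\times Y\to X\times Y$ is $(x,y)\mapsto (f(x), g(p(x),y))$. The state space graph $S(X,f)$ is the digraph with vertex set $X$ and an edge $x\to f(x)$ for each $x \in X$. $C_n$ is the directed $n$-cycle digraph with vertices $\{0,\dots,n-1\}$ and edges $i\to i+1 \bmod n$. $AS(X,f)_n$ is the set of graph maps $C_n\to S(X,f)$ (edge-preserving functions on vertices), its elements being called $n$-cycles; equivalently, it is the set of morphisms of dynamical systems $(\mathbb{Z}/n,\mathrm{succ})\to(X,f)$, and the two are identified. $\mathbb{Z}/n$ acts on $AS(X,f)_n$ by $(i\cdot c)(j) := c(i+j)$. $\mathrm{Orb}$ denotes the set of orbits. For $k\mid n$, $\mu_{n,k}\colon C_n\to C_k$ is reduction mod $k$, and $c\mu_{n,k} := c\circ\mu_{n,k}$. A cycle $c \in AS(X,f)_k$ is non-degenerate if $c = d\mu_{k,l}$ with $l \mid k$, $d \in AS(X,f)_l$ only for $l=k$, $d=c$. For every orbit $\omega$, each $\tilde c\in\omega$ is of the form $c\mu_{n,k_\omega}$ for a unique non-degenerate cycle $c\in AS(X,f)_{k_\omega}$, and as $\tilde c$ ranges over $\omega$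 these $c$ range over a single $\mathbb{Z}/k_\omega$-orbit of $AS(X,f)_{k_\omega}$, from which $c_\omega$ is chosen. Here $p\,c_\omega\colon \mathbb{Z}/k_\omega\to E$ is the composite function. *)

(* Defs.v *)
From mathcomp Require Import all_boot finmap.
From mathcomp Require Import boolp classical_sets functions cardinality.

Set Implicit Arguments.
Unset Strict Implicit.
Unset Printing Implicit Defensive.

Local Open Scope classical_set_scope.
Local Open Scope card_scope.

(* A discrete dynamical system (X, f) is given by its map f : X -> X. *)

Definition dyn_morphism (X Y : Type) (f : X -> X) (g : Y -> Y) (a : X -> Y) :
  Prop := forall x, a (f x) = g (a x).

Definition dyn_iso (X Y : Type) (f : X -> X) (g : Y -> Y) : Prop :=
  exists (a : X -> Y) (b : Y -> X),
    [/\ dyn_morphism f g a, dyn_morphism g f b, cancel a b & cancel b a].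

Definition semidirect (X Y E : Type) (f : X -> X) (g : E * Y -> Y)
  (p : X -> E) : X * Y -> X * Y := fun z => (f z.1, g (p z.1, z.2)).

(* Z/n is 'I_n for n > 0, and its successor map is ordS. The addition is
   defined on 'I_n, and not only on 'I_n.+1, because the orbit sizes below are
   not syntactically successors. *)

Lemma ord_gt0 (n : nat) (i : 'I_n) : 0 < n.
Proof. exact: leq_ltn_trans (ltn_ord i). Qed.

Definition addZ (n : nat) (i j : 'I_n) : 'I_n :=
  Ordinal (ltn_pmod (i + j) (ord_gt0 i)).

Record zset (n : nat) := ZSet {
  zset_car :> Type;
  zact : 'I_n -> zset_car -> zset_car;
  zact0 : forall (i : 'I_n) x, i = 0 :> nat -> zact i x = x;
  zactD : forall i j x, zact (addZ i j) x = zact i (zact j x) }.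

Definition zset_morphism (n : nat) (A B : zset n) (a : A -> B) : Prop :=
  forall i x, a (zact i x) = zact i (a x).

Definition zset_iso (n : nat) (A B : zset n) : Prop :=
  exists (a : A -> B) (b : B -> A),
    [/\ zset_morphism a, zset_morphism b, cancel a b & cancel b a].

Section Coproduct.
Variables (n : nat) (I : Type) (A : I -> zset n).

Definition coprod_act (i : 'I_n) (u : {t : I & A t}) : {t : I & A t} :=
  existT _ (projT1 u) (zact i (projT2 u)).

Lemma coprod_act0 (i : 'I_n) u : i = 0 :> nat -> coprod_act i u = u.
Proof. by case: u => t x i0; rewrite /coprod_act /= zact0. Qed.

Lemma coprod_actD i j u :
  coprod_act (addZ i j) u = coprod_act i (coprod_act j u).
Proof. by case: u => t x; rewrite /coprod_act /= zactD. Qed.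

Definition coprod : zset n := ZSet coprod_act0 coprod_actD.

End Coproduct.

Definition zorbit (n : nat) (A : zset n) (x : A) : set A :=
  [set y | exists i, y = zact i x].

Record Orb (n : nat) (A : zset n) := MkOrb {
  orb_set :> set A;
  orbP : exists x, orb_set = zorbit x }.

(* fset_set is meaningful only on finite sets; orbits are finite. *)
Definition orb_card (n : nat) (A : zset n) (w : Orb A) : nat :=
  #|` fset_set (orb_set w : set {classic A})|%fset.

Lemma zorbit_card (n : nat) (A : zset n) (x : A) :
  exists2 k, k %| n & zorbit x #= `I_k.
Proof.
have [n0|n_gt0] := posnP n.
  exists 0; first by rewrite n0.
  suff -> : zorbit x = set0 by rewrite II0.
  by rewrite -subset0 => y [i _]; move: (ord_gt0 i); rewrite [X in _ < X]n0.
pose z m : 'I_n := Ordinal (ltn_pmod m n_gt0).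
pose D m := zact (z m) x.
have DD a b : D (a + b) = zact (z a) (D b).
  rewrite /D -zactD; congr zact; apply: val_inj => /=.
  by rewrite modnDm.
have D0 : D 0 = x by rewrite /D zact0 //= mod0n.
have Dn : D n = x by rewrite /D zact0 //= modnn.
have exP : exists m, (0 < m) && `[< D m = x >].
  by exists n; rewrite n_gt0; apply/asboolP.
have [k /andP[k_gt0 /asboolP Dk] kmin] := ex_minnP exP.
have Dmul a q : D (a + q * k) = D a.
  elim: q => [|q IHq]; first by rewrite addn0.
  by rewrite mulSn addnCA addnC DD Dk -[in LHS]D0 -DD addn0.
have Dmod a : D (a %% k) = D a.
  by rewrite [in RHS](divn_eq a k) addnC Dmul.
exists k.
  rewrite /dvdn; have [//|m_gt0] := posnP (n %% k).
  have /kmin : (0 < n %% k) && `[< D (n %% k) = x >].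
    by rewrite m_gt0; apply/asboolP; rewrite Dmod.
  by rewrite leqNgt ltn_pmod.
have Dlt a b : a < b -> b < k -> D a <> D b.
  move=> ab bk eqD; have a_le : a <= n.
    have kn : k <= n by apply: kmin; rewrite n_gt0; apply/asboolP.
    by rewrite ltnW // (leq_trans ab) // (leq_trans (ltnW bk)).
  have : D (n - a + a) = D (n - a + b) by rewrite !DD eqD.
  have -> : n - a + b = b - a + n.
    by rewrite -{1}(subnK (ltnW ab)) addnCA subnK.
  rewrite subnK // DD Dn -{2}D0 -DD addn0 => eqx.
  have /kmin : (0 < b - a) && `[< D (b - a) = x >].
    by rewrite subn_gt0 ab; apply/asboolP.
  by rewrite leqNgt (leq_ltn_trans (leq_subr _ _) bk).
have -> : zorbit x = D @` `I_k.
  apply/seteqP; split=> y /=.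
    move=> [i ->]; exists (i %% k); first exact: ltn_pmod.
    rewrite Dmod /D; congr zact; apply: val_inj => /=.
    by rewrite modn_small.
  by move=> [a _ <-]; exists (z a).
apply: inj_card_eq => a b; rewrite !inE => ak bk eqD.
have [ab|ba|//] := ltngtP a b.
  by have := Dlt _ _ ab bk eqD.
by have := Dlt _ _ ba ak (esym eqD).
Qed.

Lemma orb_card_dvd (n : nat) (A : zset n) (w : Orb A) : orb_card w %| n.
Proof.
have [x wx] := orbP w; rewrite /orb_card wx.
have [k kn xk] := zorbit_card x.
by rewrite (@card_fset_set {classic A} _ k xk).
Qed.

Record digraph := Digraph {
  vertex :> Type;
  edge : vertex -> vertex -> Prop }.

Definition graph_map (G H : digraph) (a : G -> H) : Prop :=
  forall u v, edge u v -> edge (a u) (a v).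

Definition state_graph (X : Type) (f : X -> X) : digraph :=
  Digraph (fun x y => y = f x).

Definition cycle_graph (n : nat) : digraph :=
  Digraph (fun i j : 'I_n => j = ordS i).

Record ncycle (X : Type) (f : X -> X) (n : nat) := Cycle {
  cycle_fun : 'I_n -> X;
  cycleP : @graph_map (cycle_graph n) (state_graph f) cycle_fun }.

Lemma cycle_inj (X : Type) (f : X -> X) (n : nat) (c d : ncycle f n) :
  cycle_fun c = cycle_fun d -> c = d.
Proof.
case: c d => [c cP] [d dP] /= cd; move: cP; rewrite cd => cP.
by congr Cycle; exact: Prop_irrelevance.
Qed.

Section CycleAction.
Variables (X : Type) (f : X -> X) (n : nat).

Lemma cycle_actP (i : 'I_n) (c : ncycle f n) :
  @graph_map (cycle_graph n) (state_graph f)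
    (fun j => cycle_fun c (addZ i j)).
Proof.
move=> j _ /= ->; apply: cycleP => /=; apply: val_inj => /=.
by rewrite modnDmr addnS -[in RHS]addn1 modnDml addn1.
Qed.

Definition cycle_act (i : 'I_n) (c : ncycle f n) : ncycle f n :=
  Cycle (cycle_actP i c).

Lemma cycle_act0 (i : 'I_n) (c : ncycle f n) :
  i = 0 :> nat -> cycle_act i c = c.
Proof.
move=> i0; apply: cycle_inj; apply: funext => j /=; congr cycle_fun.
by apply: val_inj; rewrite /= i0 add0n modn_small.
Qed.

Lemma cycle_actD (i j : 'I_n) (c : ncycle f n) :
  cycle_act (addZ i j) c = cycle_act i (cycle_act j c).
Proof.
apply: cycle_inj; apply: funext => l /=; congr cycle_fun.
by apply: val_inj; rewrite /= modnDml modnDmr addnA (addnC i).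
Qed.

Definition AS : zset n := ZSet cycle_act0 cycle_actD.

End CycleAction.

Definition mu (n k : nat) (kn : k %| n) (i : 'I_n) : 'I_k :=
  Ordinal (ltn_pmod i (dvdn_gt0 (ord_gt0 i) kn)).

Lemma muP (n k : nat) (kn : k %| n) :
  @graph_map (cycle_graph n) (cycle_graph k) (mu kn).
Proof.
move=> i _ /= ->; apply: val_inj => /=.
by rewrite modn_dvdm // -[in RHS]addn1 modnDml addn1.
Qed.

Lemma comp_muP (X : Type) (f : X -> X) (n k : nat) (kn : k %| n)
    (c : ncycle f k) :
  @graph_map (cycle_graph n) (state_graph f) (cycle_fun c \o mu kn).
Proof. by move=> i j ij; apply: cycleP; exact: muP. Qed.

Definition comp_mu (X : Type) (f : X -> X) (n k : nat) (kn : k %| n)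
  (c : AS f k) : AS f n := Cycle (comp_muP kn c).

(* The equality of dependent pairs says that l = k and d = c. *)
Definition nondegenerate (X : Type) (f : X -> X) (k : nat) (c : AS f k) :
  Prop :=
  forall (l : nat) (lk : l %| k) (d : AS f l), c = comp_mu lk d ->
    existT (fun m => zset_car (AS f m)) l d = existT _ k c.

(* Main.v *)
Require Import Defs.
From mathcomp Require Import all_boot finmap.
From mathcomp Require Import boolp classical_sets functions cardinality.

(** The map [(i, y) |-> (c_w i, y)] is a morphism from
    [(Z/k_w * Y, succ >< g)] to [(X * Y, f >< g)], and together these induce
    the isomorphism, from right to left. Everything rests on two facts: a cycle
    is determined by its value at one point, and [c_w] is injective, because
    the [k_w] shifts of [c_w \o mu] exhaust the orbit [w], which has [k_w]
    elements. A cycle of the semi-direct product then comes exactly from the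
    summand of the orbit [w] of its first projection [x], since [x] is a shift
    of [c_w \o mu]. *)

Set Implicit Arguments.
Unset Strict Implicit.
Unset Printing Implicit Defensive.

Local Open Scope classical_set_scope.

Lemma addZS (n : nat) (i j : 'I_n) : addZ i (ordS j) = ordS (addZ i j).
Proof.
by apply: val_inj; rewrite /= modnDmr addnS -[in RHS]addn1 modnDml addn1.
Qed.

Definition oppZ (n : nat) (i : 'I_n) : 'I_n :=
  Ordinal (ltn_pmod (n - i) (ord_gt0 i)).

Lemma addZK (n : nat) (i : 'I_n) : cancel (addZ i) (addZ (oppZ i)).
Proof.
move=> j; apply: val_inj => /=.
by rewrite modnDml modnDmr addnA subnK ?(ltnW (ltn_ord i)) // modnDl modn_small.
Qed.

Lemma addNZK (n : nat) (i : 'I_n) : cancel (addZ (oppZ i)) (addZ i).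
Proof.
move=> j; apply: val_inj => /=.
rewrite modnDmr addnCA modnDml addnA subnK ?(ltnW (ltn_ord i)) //.
by rewrite modnDl modn_small.
Qed.

Lemma zactK (n : nat) (A : zset n) (i : 'I_n) (x : A) :
  zact (oppZ i) (zact i x) = x.
Proof.
rewrite -zactD zact0 //= modnDml subnK ?(ltnW (ltn_ord i)) //.
exact: modnn.
Qed.

Lemma zorbit_eq (n : nat) (A : zset n) (x y : A) :
  zorbit x y -> zorbit x = zorbit y.
Proof.
move=> [i ->]; apply/seteqP; split=> z [j ->].
  by exists (addZ j (oppZ i)); rewrite zactD zactK.
by exists (addZ j i); rewrite zactD.
Qed.

Lemma Orb_zorbit (n : nat) (A : zset n) (w : Orb A) (x : A) :
  orb_set w x -> orb_set w = zorbit x.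
Proof. by case: (orbP w) => y -> /zorbit_eq. Qed.

Lemma Orb_eq (n : nat) (A : zset n) (w w' : Orb A) (x : A) :
  orb_set w x -> orb_set w' x -> w = w'.
Proof.
move=> /Orb_zorbit wx /Orb_zorbit; rewrite -wx.
case: w w' {wx} => [s sP] [s' s'P] /= ss'; rewrite ss' in s'P *.
by congr MkOrb; exact: Prop_irrelevance.
Qed.

Lemma finite_Orb (n : nat) (A : zset n) (w : Orb A) : finite_set (orb_set w).
Proof.
by have [x ->] := orbP w; have [k _ xk] := zorbit_card x; exists k.
Qed.

(** The inverse comes from choice; it is equivariant because [a] is equivariant and injective. *)
Lemma bij_zset_iso (n : nat) (A B : zset n) (a : B -> A) :
  zset_morphism a -> injective a -> (forall x, exists y, a y = x) ->
  zset_iso A B.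
Proof.
move=> aM aI /choice[b bK]; exists b, a; split=> //.
- by move=> i x; apply: aI; rewrite aM !bK.
- by move=> y; apply: aI; rewrite bK.
Qed.

Lemma cycle_ordS (X : Type) (f : X -> X) (n : nat) (c : AS f n) (i : 'I_n) :
  cycle_fun c (ordS i) = f (cycle_fun c i).
Proof. exact: (cycleP c (v := ordS i)). Qed.

Lemma cycle_iter (X : Type) (f : X -> X) (n : nat) (c : AS f n) (i : 'I_n)
    (m : nat) :
  cycle_fun c (iter m (@ordS n) i) = iter m f (cycle_fun c i).
Proof. by elim: m => //= m <-; exact: cycle_ordS. Qed.

Lemma iter_ordS (n : nat) (i : 'I_n) (m : nat) :
  iter m (@ordS n) i = (i + m) %% n :> nat.
Proof.
elim: m => [|m /= ->]; first by rewrite addn0 modn_small.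
by rewrite -addn1 modnDml addn1 addnS.
Qed.

(** Every position is reached from [i] by iterating [ordS], and cycles turn these iterates into
    iterates of [f]. Here [n - i + j] is a natural number representing the difference of [j] and [i]
    mod [n]. *)
Lemma eq_cycle (X : Type) (f : X -> X) (n : nat) (c d : AS f n) (i : 'I_n) :
  cycle_fun c i = cycle_fun d i -> c = d.
Proof.
move=> cdi; apply: cycle_inj; apply: funext => j.
suff -> : j = iter (n - i + j) (@ordS n) i by rewrite !cycle_iter cdi.
apply: val_inj; rewrite /= iter_ordS addnA subnKC ?(ltnW (ltn_ord i)) //.
by rewrite modnDl modn_small.
Qed.

Lemma AS_mapP (X Z : Type) (f : X -> X) (h : Z -> Z) (a : X -> Z)
    (aM : dyn_morphism f h a) (n : nat) (c : AS f n) :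
  @graph_map (cycle_graph n) (state_graph h) (a \o cycle_fun c).
Proof. by move=> i _ /= ->; rewrite cycle_ordS aM. Qed.

Definition AS_map (X Z : Type) (f : X -> X) (h : Z -> Z) (a : X -> Z)
  (aM : dyn_morphism f h a) (n : nat) (c : AS f n) : AS h n :=
  Cycle (AS_mapP aM c).

Lemma AS_map_morphism (X Z : Type) (f : X -> X) (h : Z -> Z) (a : X -> Z)
    (aM : dyn_morphism f h a) (n : nat) :
  zset_morphism (@AS_map _ _ _ _ _ aM n).
Proof. by move=> i c; exact: cycle_inj. Qed.

Lemma fst_morphism (X Y E : Type) (f : X -> X) (g : E * Y -> Y) (p : X -> E) :
  dyn_morphism (semidirect f g p) f fst.
Proof. by []. Qed.

Lemma semidirect_morphism (W X Y E : Type) (e : W -> W) (f : X -> X)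
    (g : E * Y -> Y) (p : X -> E) (a : W -> X) :
  dyn_morphism e f a ->
  dyn_morphism (semidirect e g (p \o a)) (semidirect f g p)
    (fun z => (a z.1, z.2)).
Proof. by move=> aM z; rewrite /semidirect /= aM. Qed.

Lemma comp_mu_act (X : Type) (f : X -> X) (n k : nat) (kn : k %| n)
    (c : AS f k) (i : 'I_n) :
  comp_mu kn (zact (mu kn i) c) = zact i (comp_mu kn c).
Proof.
apply: (eq_cycle (i := i)) => /=; congr cycle_fun; apply: val_inj => /=.
by rewrite modnDm modn_dvdm.
Qed.

Lemma mu_surj (n k : nat) (kn : k %| n) (n_gt0 : 0 < n) (i : 'I_k) :
  exists j, mu kn j = i.
Proof.
exists (Ordinal (leq_trans (ltn_ord i) (dvdn_leq n_gt0 kn))).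
by apply: val_inj; rewrite /= modn_small.
Qed.

(** A counting argument: the [orb_card w] shifts of [c], pulled back along [mu], cover an orbit with
    [orb_card w] elements, so they are pairwise distinct. *)
Lemma orb_cycle_inj (X : Type) (f : X -> X) (n : nat) (n_gt0 : 0 < n)
    (w : Orb (AS f n)) (c : AS f (orb_card w)) :
  orb_set w (comp_mu (orb_card_dvd w) c) -> injective (cycle_fun c).
Proof.
set kn := orb_card_dvd w => wc.
pose phi (i : 'I_(orb_card w)) : {classic AS f n} := comp_mu kn (zact i c).
have phi_inj : injective phi.
  apply/injectiveP; rewrite /injectiveb /dinjectiveb.
  (* A list with the same elements and the same length as a duplicate-free list is itself
     duplicate-free. *)
  rewrite -(@eq_uniq _ (fset_set (orb_set w : set {classic AS f n}))) //.
    by rewrite size_map -cardE card_ord.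
  move=> y; rewrite in_fset_set; last exact: finite_Orb.
  rewrite (Orb_zorbit wc); apply/idP/fintype.imageP => [|[i _ ->]].
    rewrite inE => -[j ->]; exists (mu kn j) => //.
    by rewrite /phi comp_mu_act.
  have [j <-] := mu_surj kn n_gt0 i.
  by rewrite inE; exists j; rewrite /phi comp_mu_act.
move=> i j cij; apply: phi_inj; congr comp_mu.
have k_gt0 := ord_gt0 i.
(* At position 0 the shifts by [i] and [j] take the values of [c] at [i] and [j], which agree. *)
apply: (eq_cycle (i := Ordinal k_gt0)) => /=.
suff add0 l : addZ l (Ordinal k_gt0) = l by rewrite !add0.
by apply: val_inj; rewrite /= addn0 modn_small.
Qed.

(** Translating the first coordinate by [oppZ i] cancels the shift of [c] by [i], so [g] receives
    the same argument on both sides. *)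
Lemma semidirect_act_iso (X Y E : Type) (f : X -> X) (g : E * Y -> Y)
    (p : X -> E) (k : nat) (c : AS f k) (i : 'I_k) :
  dyn_iso (semidirect (@ordS k) g (p \o cycle_fun c))
          (semidirect (@ordS k) g (p \o cycle_fun (zact i c))).
Proof.
exists (fun z => (addZ (oppZ i) z.1, z.2)), (fun z => (addZ i z.1, z.2)).
by split=> -[j y]; rewrite /semidirect /= ?addZS ?addNZK ?addZK.
Qed.

Theorem theorem2p5 (X Y E : Type) (f : X -> X) (g : E * Y -> Y) (p : X -> E)
  (n : nat) (n_gt0 : 0 < n)
  (c : forall w : Orb (AS f n), AS f (orb_card w))
  (c_nondeg : forall w : Orb (AS f n), nondegenerate (c w))
  (c_mem : forall w : Orb (AS f n), orb_set w (comp_mu (orb_card_dvd w) (c w))) :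
  zset_iso (AS (semidirect f g p) n)
    (coprod (fun w : Orb (AS f n) =>
       AS (semidirect (@ordS (orb_card w)) g (p \o cycle_fun (c w))) n)) /\
  (forall (w : Orb (AS f n)) (c' : AS f (orb_card w)), zorbit (c w) c' ->
     dyn_iso (semidirect (@ordS (orb_card w)) g (p \o cycle_fun (c w)))
             (semidirect (@ordS (orb_card w)) g (p \o cycle_fun c'))).
Proof.
split; last by move=> w _ [i ->]; exact: semidirect_act_iso.
have cM w := semidirect_morphism g p (cycle_ordS (c w)).
pose o := Ordinal n_gt0.
pose a (u : coprod (fun w => AS (semidirect (@ordS (orb_card w)) g
    (p \o cycle_fun (c w))) n)) : AS (semidirect f g p) n :=
  AS_map (cM (projT1 u)) (projT2 u).
apply: (bij_zset_iso (a := a)).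
- by move=> i [w d]; exact: AS_map_morphism.
(* Injectivity: the image of [d] remembers its summand. Its first projection is the shift of
   [comp_mu _ (c w)] by any [j] lifting the first coordinate of [d] at 0. *)
- have fst_mem w d : orb_set w (AS_map (@fst_morphism _ _ _ f g p)
      (AS_map (cM w) d : AS (semidirect f g p) n)).
    rewrite (Orb_zorbit (c_mem w)).
    have [j jd] := mu_surj (orb_card_dvd w) n_gt0 (cycle_fun d o).1.
    exists j; rewrite -comp_mu_act; apply: (eq_cycle (i := o)) => /=.
    congr cycle_fun; rewrite jd; apply: val_inj => /=.
    by rewrite mod0n addn0 modn_small.
  move=> [w d] [w' d'] add'.
  have {add'} dd' : AS_map (cM w) d = AS_map (cM w') d' := add'.
  have ww' : w = w'.
    by have := fst_mem w d; rewrite dd' => /Orb_eq; apply; exact: fst_mem.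
  rewrite -{w'}ww' in d' dd' *; congr existT; apply: (eq_cycle (i := o)).
  (* Within one summand, compare values at 0: the [Y] coordinates agree directly, the others by
     injectivity of [c w]. *)
  have := congr1 (fun z : AS _ _ => cycle_fun z o) dd'.
  rewrite /= [RHS]surjective_pairing [cycle_fun d o]surjective_pairing /=.
  by case=> /(orb_cycle_inj n_gt0 (c_mem w)) -> ->; rewrite -surjective_pairing.
- move=> z; pose x := AS_map (@fst_morphism _ _ _ f g p) z.
  pose w := MkOrb (ex_intro _ x erefl : exists y, zorbit x = zorbit y).
  have [j xj] : zorbit (comp_mu (orb_card_dvd w) (c w)) x.
    rewrite -(Orb_zorbit (c_mem w)).
    by exists o; rewrite zact0.
  (* The preimage of [z]: since [x] is the shift by [j] of [comp_mu _ (c w)], the value of [x] at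
     [t] is that of [c w] at the residue of [j + t]. *)
  pose h t := (mu (orb_card_dvd w) (addZ j t), (cycle_fun z t).2).
  have ch t : cycle_fun (c w) (h t).1 = (cycle_fun z t).1.
    by have /(congr1 (fun y : AS _ _ => cycle_fun y t)) /= := xj.
  have hP : @graph_map (cycle_graph n) (state_graph
      (semidirect (@ordS (orb_card w)) g (p \o cycle_fun (c w)))) h.
    move=> t _ /= ->; rewrite {2}/h /semidirect /=.
    rewrite ch /h cycle_ordS /semidirect /= addZS; congr pair.
    exact: muP.
  exists (existT _ w (Cycle hP)).
  apply: (eq_cycle (i := o)); rewrite /= ch.
  by rewrite -surjective_pairing.
Qed.
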